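(* Let $G$ be a $2$-tree of order $n\ge 3$. Then \[\bar{\kappa}_{\max}(G)\ge 1+\frac{n-3}{n(n-1)},\] and this bound is sharp for all $n$: for every $n\ge 3$ there is a $2$-tree of order $n$ attaining equality.
   Context: Graphs are finite and simple. $2$-trees are defined recursively: $K_2$ is a $2$-tree, and if $T$ is a $2$-tree, then the graph obtained from $T$ by adding a new vertex adjacent to both ends of some edge of $T$ is a $2$-tree. An orientation of $G$ is obtained by directing each edge. For a digraph $D$ and distinct vertices $u,v$, $\kappa_D(u,v)$ is the maximum number of internally disjoint directed $u$--$v$ paths; for $D$ of order $n$, $\bar{\kappa}(D)=\frac{1}{n(n-1)}\sum_{(u,v)}\kappa_D(u,v)$ over ordered pairs of distinct vertices; $\bar{\kappa}_{\max}(G)$ is the maximum of $\bar{\kappa}(D)$ over all orientations $D$ of $G$. *)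

(* Defs.v *)
From HB Require Import structures.
From mathcomp Require Import all_boot all_order all_algebra.

Set Implicit Arguments.
Unset Strict Implicit.
Unset Printing Implicit Defensive.

Import Order.TTheory GRing.Theory Num.Theory.

Record sgraph := SGraph {
  vertex :> finType;
  adj : rel vertex;
  adj_sym : symmetric adj;
  adj_irrefl : irreflexive adj
}.

Definition sgraph_iso (G H : sgraph) : Prop :=
  exists2 f : G -> H, bijective f & forall x y, adj (f x) (f y) = adj x y.

Lemma K2_sym : symmetric (fun x y : bool => x != y).
Proof. by case; case. Qed.

Lemma K2_irrefl : irreflexive (fun x y : bool => x != y).
Proof. by case. Qed.

Definition K2 : sgraph := SGraph K2_sym K2_irrefl.

Section AddVertex.
Variables (G : sgraph) (x y : G).

(* The new vertex is [None]; its neighbours are [x] and [y]. *)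
Definition add_vertex_adj : rel (option G) := fun a b =>
  match a, b with
  | Some a, Some b => adj a b
  | Some z, None | None, Some z => (z == x) || (z == y)
  | None, None => false
  end.

Lemma add_vertex_sym : symmetric add_vertex_adj.
Proof. by case=> [a|] [b|] //=; exact: adj_sym. Qed.

Lemma add_vertex_irrefl : irreflexive add_vertex_adj.
Proof. by case=> [a|] //=; exact: adj_irrefl. Qed.

Definition add_vertex : sgraph := SGraph add_vertex_sym add_vertex_irrefl.

End AddVertex.

Inductive two_tree : sgraph -> Prop :=
| two_tree_K2 : two_tree K2
| two_tree_add (G : sgraph) (x y : G) :
    two_tree G -> adj x y -> two_tree (add_vertex x y)
| two_tree_iso (G H : sgraph) : two_tree G -> sgraph_iso G H -> two_tree H.

(* A digraph on [V] is given by its set of arcs. *)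
Definition digraph (V : finType) := {set V * V}.

Definition arc (V : finType) (D : digraph V) : rel V := fun u v => (u, v) \in D.

Definition orientation (G : sgraph) (D : digraph G) : bool :=
  [forall u, forall v,
    (adj u v == (arc D u v || arc D v u)) && ~~ (arc D u v && arc D v u)].

(* A directed u--v path is represented by the sequence of its internal
   vertices, so the arc (u, v) itself is the empty sequence. *)
Definition dipath (V : finType) (D : digraph V) (u v : V) (p : seq V) : bool :=
  path (arc D) u (rcons p v) && uniq (u :: rcons p v).

(* A family of paths is a set, so the arc (u, v) counts at most once. The length
   bound in [{bseq #|V| of V}] excludes no path, as its vertices are distinct. *)
Definition disjoint_dipaths (V : finType) (D : digraph V) (u v : V)
    (P : {set {bseq #|V| of V}}) : bool :=
  [forall p in P, dipath D u v p] &&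
  [forall p in P, forall q in P, (p != q) ==> ~~ has (mem (p : seq V)) q].

Definition kappa (V : finType) (D : digraph V) (u v : V) : nat :=
  \max_(P : {set {bseq #|V| of V}} | disjoint_dipaths D u v P) #|P|.

Local Open Scope ring_scope.

Definition kappa_bar (V : finType) (D : digraph V) : rat :=
  (\sum_(u : V) \sum_(v : V | v != u) (kappa D u v)%:R)
    / (#|V|%:R * (#|V|%:R - 1)).

(* The default value 0 is harmless: averages are nonnegative and every graph
   has an orientation. *)
Definition kappa_bar_max (G : sgraph) : rat :=
  \big[Num.max/0]_(D : digraph G | orientation D) kappa_bar D.

(* Main.v *)
(** Lower bound: orient the first triangle cyclically and, whenever a vertex [z]
    is attached to an edge carrying the arc [x -> y], add the arcs [y -> z -> x].
    The orientation stays strong, so each of the new ordered pairs contributes at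
    least 1, and the new path [y, z, x] raises the connectivity from [y] to [x]
    by 1. Hence the total connectivity is at least [n ^ 2 - 3], starting from
    the value 1 on [K2].

    Sharpness: in every orientation, [kappa u v + kappa v u <= deg u], because
    [kappa u v] is at most the outdegree of [u] and [kappa v u] at most its
    indegree. In the book graph ([n - 2] triangles sharing an edge) all pairs but
    the spine contain a vertex of degree 2, so the total connectivity is at most
    [n (n - 1) - 2 + (n - 1) = n ^ 2 - 3]. *)

From mathcomp Require Import all_boot all_order all_algebra.
From mathcomp Require Import zify ring lra.
Require Import Defs.

Import Order.TTheory GRing.Theory Num.Theory.

Set Implicit Arguments.
Unset Strict Implicit.
Unset Printing Implicit Defensive.

Definition internally_disjoint (V : eqType) (s : seq (seq V)) :=
  {in s &, forall p q : seq V, p != q -> ~~ has (mem p) q}.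

Definition total_kappa (V : finType) (D : digraph V) :=
  \sum_(u : V) \sum_(v : V | v != u) kappa D u v.

Definition strong (V : finType) (D : digraph V) :=
  forall u v, connect (arc D) u v.

Definition nbh (G : sgraph) (u : G) := [set w | adj u w].

(** * Bounds on connectivity within one digraph *)

Section Kappa.
Variables (V : finType) (D : digraph V).
Implicit Types (u v : V) (s : seq (seq V)).

Lemma size_dipath u v p : dipath D u v p -> size p <= #|V|.
Proof.
case/andP=> _ /= /andP[_]; rewrite rcons_uniq => /andP[_ up].
by rewrite -(card_uniqP up) max_card.
Qed.

(** Together with [kappa_witness], this trades sets of bounded sequences for duplicate-free lists of
    plain sequences, which are easier to map and extend. *)
Lemma kappa_ge u v s :
  uniq s -> {in s, forall p, dipath D u v p} -> internally_disjoint s ->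
  size s <= kappa D u v.
Proof.
move=> us ps ds.
pose P := [set b : {bseq #|V| of V} | (b : seq V) \in s].
have eqP_s : image (@bseqval #|V| V) P =i s.
  move=> p; apply/imageP/idP => [[b] | sp].
    by rewrite inE => sb ->.
  by exists (Bseq (size_dipath (ps _ sp))); rewrite ?inE.
have -> : size s = #|P|.
  rewrite -(size_image (@bseqval #|V| V) P).
  apply/esym/perm_size/uniq_perm => //.
  by rewrite map_inj_uniq ?enum_uniq //; exact: val_inj.
apply: (leq_bigmax_cond (F := fun P : {set {bseq #|V| of V}} => #|P|)).
apply/andP; split.
  by apply/forall_inP => b; rewrite inE; exact: ps.
apply/forall_inP => b; rewrite inE => sb; apply/forall_inP => c; rewrite inE => sc.
by apply/implyP => bc; exact: ds.
Qed.

Lemma kappa_witness u v :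
  exists s, [/\ size s = kappa D u v, uniq s,
    {in s, forall p, dipath D u v p} & internally_disjoint s].
Proof.
(* The empty family is admissible, so the maximum is attained by some family. *)
have P0 : disjoint_dipaths D u v set0.
  by apply/andP; split; apply/forall_inP => b; rewrite inE.
rewrite /kappa.
have [|P /andP[/forall_inP Pp /forall_inP Pd] ->] :=
  @eq_bigmax_cond _ (disjoint_dipaths D u v)
    (fun P : {set {bseq #|V| of V}} => #|P|).
  by apply/card_gt0P; exists set0.
exists (image (@bseqval #|V| V) P); split.
- by rewrite size_image.
- by rewrite map_inj_uniq ?enum_uniq //; exact: val_inj.
- by move=> _ /imageP[b bP ->]; exact: Pp.
move=> _ _ /imageP[b bP ->] /imageP[c cP ->] bc.
by apply: (implyP (forall_inP (Pd b bP) c cP)).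
Qed.

(** Pigeonhole: [f] assigns to each path a key in [A], and two distinct paths with the same key
    share an internal vertex, so disjoint paths have distinct keys. *)
Lemma leq_kappa_card u v (f : seq V -> V) (A : {set V}) :
  (forall p, dipath D u v p -> f p \in A) ->
  (forall p q, dipath D u v p -> dipath D u v q -> f p = f q ->
     p != q -> has (mem p) q) ->
  kappa D u v <= #|A|.
Proof.
move=> fA finj; have [s [<- us ps ds]] := kappa_witness u v.
have ufs : uniq (map f s).
  rewrite map_inj_in_uniq // => p q sp sq efpq; apply/eqP; apply/negPn/negP => npq.
  by move: (ds p q sp sq npq); rewrite (finj p q) ?ps.
rewrite -(size_map f) -(card_uniqP ufs); apply/subset_leq_card/subsetP => _ /mapP[p sp ->].
exact/fA/ps.
Qed.

Lemma kappa_outdeg u v : kappa D u v <= #|[set w | arc D u w]|.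
Proof.
(* The key is the second vertex of the path, which is [v] itself when the path is a single arc. *)
apply: (@leq_kappa_card _ _ (head v)) => [p | p q].
  by case/andP=> pth _; case: p pth => [|a p] /= /andP[]; rewrite inE.
(* If exactly one path is the direct arc, equal keys would make [v] an internal vertex of the other,
   against uniqueness. *)
case/andP=> _ up /andP[_ uq]; case: p up => [|a p] /=; case: q uq => [|b q] //=.
- by move=> + _ E; rewrite -E !mem_rcons !inE eqxx andbF.
- by move=> _ + E; rewrite E !mem_rcons !inE eqxx andbF.
- by move=> _ _ -> _; rewrite inE eqxx.
Qed.

Lemma kappa_indeg u v : kappa D u v <= #|[set w | arc D w v]|.
Proof.
apply: (@leq_kappa_card _ _ (last u)) => [p | p q].
  by case/andP; rewrite rcons_path inE => /andP[].
rewrite /dipath; case/andP=> _ up /andP[_ uq].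
case/lastP: p up => [|p a] up; case/lastP: q uq => [|q b] uq //=; rewrite ?last_rcons.
- by move=> E; move: uq; rewrite E /= !(mem_rcons, inE) eqxx orbT.
- by move=> E; move: up; rewrite E /= !(mem_rcons, inE) eqxx orbT.
- by move=> -> _; rewrite has_rcons /= mem_rcons inE eqxx.
Qed.

Lemma connect_kappa_gt0 u v : u != v -> connect (arc D) u v -> 0 < kappa D u v.
Proof.
move=> uv /connectP[p pth E]; case/shortenP: pth E => q pq uq _ E.
case/lastP: q => [|q w] in pq uq E *; first by rewrite E eqxx in uv.
rewrite last_rcons in E; subst w; apply: (@kappa_ge u v [:: q]) => //.
  by move=> r; rewrite inE => /eqP->; apply/andP.
by move=> r t; rewrite !inE => /eqP-> /eqP->; rewrite eqxx.
Qed.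

End Kappa.

(** * Transport along injective homomorphisms *)

Section Embedding.
Variables (V W : finType) (D : digraph V) (E : digraph W) (f : V -> W).
Hypotheses (f_inj : injective f) (f_arc : {homo f : u v / arc D u v >-> arc E u v}).

Lemma dipath_map u v p : dipath D u v p -> dipath E (f u) (f v) (map f p).
Proof.
case/andP=> pth up; apply/andP; split.
  by rewrite -map_rcons; apply: homo_path pth.
by rewrite -map_rcons -map_cons map_inj_uniq.
Qed.

Lemma internally_disjoint_map s :
  internally_disjoint s -> internally_disjoint (map (map f) s).
Proof.
move=> ds _ _ /mapP[p sp ->] /mapP[q sq ->] npq.
have /hasPn dpq : ~~ has (mem p) q by apply: ds => //; apply: contraNneq npq => ->.
by apply/hasPn => _ /mapP[x xq ->]; rewrite /= mem_map //; exact: dpq.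
Qed.

Lemma leq_kappa u v : kappa D u v <= kappa E (f u) (f v).
Proof.
have [s [<- us ps ds]] := kappa_witness D u v.
rewrite -(size_map (map f)); apply: kappa_ge; last exact: internally_disjoint_map.
  by rewrite map_inj_uniq //; exact: inj_map.
by move=> _ /mapP[p sp ->]; exact/dipath_map/ps.
Qed.

Lemma connect_map u v : connect (arc D) u v -> connect (arc E) (f u) (f v).
Proof.
case/connectP=> p pth ->; apply/connectP; exists (map f p); last by rewrite last_map.
exact: homo_path pth.
Qed.

(** Since [z] lies outside the image of [f], the path through [z] alone is disjoint from the images
    of a maximum family and can be added to it. *)
Lemma kappa_detour u v z :
  (forall w, f w != z) -> u != v -> arc E (f u) z -> arc E z (f v) ->
  kappa D u v < kappa E (f u) (f v).
Proof.
move=> fz uv auz azv; have [s [<- us ps ds]] := kappa_witness D u v.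
have zs p : p \in map (map f) s -> z \notin p.
  by case/mapP=> q _ ->; apply/mapP => -[w _ /eqP]; rewrite eq_sym (negPf (fz w)).
rewrite -(size_map (map f)) -[X in X <= _]/(size ([:: z] :: map (map f) s)).
apply: kappa_ge.
- rewrite /= map_inj_uniq ?us ?andbT; last exact: inj_map.
  by apply/negP => /zs; rewrite inE eqxx.
- move=> p; rewrite inE => /predU1P[-> | /mapP[q sq ->]]; last exact/dipath_map/ps.
  by rewrite /dipath /= auz azv !inE (inj_eq f_inj) negb_or (negPf uv) fz eq_sym fz.
- move=> p q; rewrite !inE => /predU1P[-> | sp] /predU1P[-> | sq]; rewrite ?eqxx //.
  + by move=> _; apply/hasPn => w wq; rewrite /= inE; apply: contraNneq (zs _ sq) => <-.
  + by move=> _; rewrite /= orbF; exact: zs.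
  + exact: (internally_disjoint_map ds) sp sq.
Qed.

End Embedding.

(** * Orientations: the degree bound and the invariant for the lower bound *)

Section Orientation.
Variables (G : sgraph) (D : digraph G).
Hypothesis oD : orientation D.

Lemma orientation_adj (u v : G) : adj u v = arc D u v || arc D v u.
Proof. by move/forallP/(_ u)/forallP/(_ v)/andP: oD => [/eqP]. Qed.

Lemma orientation_asym (u v : G) : ~~ (arc D u v && arc D v u).
Proof. by move/forallP/(_ u)/forallP/(_ v)/andP: oD => []. Qed.

Lemma kappa_sym_deg u v : kappa D u v + kappa D v u <= #|nbh u|.
Proof.
apply: leq_trans (leq_add (kappa_outdeg D u v) (kappa_indeg D v u)) _.
rewrite -cardsUI [_ :&: _](_ : _ = set0) ?cards0 ?addn0.
  by apply/subset_leq_card/subsetP => w; rewrite !inE orientation_adj.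
by apply/setP => w; rewrite !inE (negPf (orientation_asym u w)).
Qed.

End Orientation.

(* [K2] has no strong orientation, hence the alternative. *)
Definition well_orientable (G : sgraph) :=
  exists D : digraph G, [/\ orientation D, #|G| = 2 \/ strong D &
    #|G| ^ 2 <= total_kappa D + 3].

Lemma well_orientable_iso (G H : sgraph) :
  sgraph_iso G H -> well_orientable G -> well_orientable H.
Proof.
case=> f bf fadj [D [oD sD kD]]; have f_inj := bij_inj bf.
have cGH : #|G| = #|H| := bij_eq_card bf.
pose E : digraph H := [set (f a.1, f a.2) | a in D].
have arcE u v : arc E (f u) (f v) = arc D u v.
  apply/imsetP/idP => [[[a b] Dab [/f_inj-> /f_inj->]] // | Duv].
  by exists (u, v).
case: (bf) => g gK fK; exists E; split.
- apply/forallP => u; apply/forallP => v; rewrite -(fK u) -(fK v) fadj !arcE.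
  by rewrite (orientation_adj oD) eqxx (orientation_asym oD).
- case: sD => [c2 | sD]; [by left; rewrite -cGH | right => u v].
  by rewrite -(fK u) -(fK v); apply: connect_map (sD _ _) => a b; rewrite arcE.
rewrite -cGH (leq_trans kD) // leq_add2r /total_kappa.
rewrite [leqRHS](reindex f) /=; last exact: onW_bij.
apply: leq_sum => u _; rewrite [leqRHS](reindex f) /=; last exact: onW_bij.
under [leqRHS]eq_bigl do rewrite (inj_eq f_inj).
apply: leq_sum => v _.
by apply: leq_kappa => // a b; rewrite arcE.
Qed.

Lemma well_orientable_K2 : well_orientable K2.
Proof.
pose D : digraph K2 := [set (false, true)].
exists D; split.
- by apply/forallP => -[]; apply/forallP => -[]; rewrite /arc !inE.
- by left; rewrite card_bool.
(* With [#|K2| ^ 2 = 4], the claim reduces to a positive total, supplied by the single arc. *)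
rewrite card_bool addn3 !ltnS lt0n /total_kappa.
rewrite -lt0n (bigD1 false) //= (bigD1 true) //= !addn_gt0.
by rewrite connect_kappa_gt0 //; apply: connect1; rewrite /arc inE.
Qed.

Lemma sum_option (T : finType) (F : option T -> nat) (P : pred (option T)) :
  \sum_(u | P u) F u =
  (if P None then F None else 0) + \sum_(u | P (Some u)) F (Some u).
Proof.
have perm : perm_eq (index_enum (option T)) (None :: map Some (index_enum T)).
  apply: uniq_perm; first exact: index_enum_uniq.
    rewrite /= (map_inj_uniq Some_inj) index_enum_uniq andbT.
    by apply/mapP => -[].
  by case=> [u|]; rewrite !mem_index_enum inE //= mem_map ?mem_index_enum //; exact: Some_inj.
by rewrite (perm_big _ perm) big_cons big_map; case: (P None).
Qed.

(** This evaluates a correction attached to one ordered pair: the gain from [y] to [x] in the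
    extension, and the two spine pairs in the book. *)
Lemma sum_indicator_pair (V : finType) (a b : V) : a != b ->
  \sum_u \sum_(v | v != u) ((u == a) && (v == b)) = 1.
Proof.
move=> ab; rewrite (bigD1 a) //= (bigD1 b) 1?eq_sym //= !eqxx big1 => [|v /andP[_ /negPf->]] //.
by rewrite big1 // => u /negPf->; rewrite big1.
Qed.

(** * Adding a vertex along an oriented edge *)

Section AddVertexOrientation.
Variables (G : sgraph) (x y : G) (D : digraph G).
Hypotheses (oD : orientation D) (xy : arc D x y).

Definition cyclic_extension : digraph (add_vertex x y) :=
  [set a | match a with
           | (Some u, Some v) => arc D u v
           | (Some u, None) => u == y
           | (None, Some v) => v == x
           | (None, None) => false
           end].

Let E := cyclic_extension.

Let neq_yx : y != x.
Proof.
apply/eqP => yx; move: (orientation_asym oD x y) (xy).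
by rewrite yx andbb => /negPf->.
Qed.

Lemma cyclic_extension_orientation : orientation E.
Proof.
apply/forallP => -[u|]; apply/forallP => -[v|]; rewrite /arc !inE //=.
- by rewrite (orientation_adj oD) eqxx; exact: orientation_asym.
- rewrite orbC eqxx /=; apply/negP => /andP[/eqP-> yx].
  by move: neq_yx; rewrite yx.
- rewrite eqxx /=; apply/negP => /andP[/eqP-> xy'].
  by move: neq_yx; rewrite eq_sym xy'.
Qed.

Let Some_arc : {homo Some : u v / arc D u v >-> arc E u v}.
Proof. by move=> u v; rewrite {2}/arc inE. Qed.

(** The new vertex is a hub: every vertex reaches [None] through [y] and is reached from it through
    [x]. If [G] has order 2, all vertices lie on the new directed triangle. *)
Lemma cyclic_extension_strong : #|G| = 2 \/ strong D -> strong E.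
Proof.
move=> sD.
have cyN : connect (arc E) (Some y) None by apply: connect1; rewrite /arc inE.
have cNx : connect (arc E) None (Some x) by apply: connect1; rewrite /arc inE.
have cxy : connect (arc E) (Some x) (Some y) by apply/connect1/Some_arc.
have VG u : #|G| = 2 -> (u == x) || (u == y).
  move=> c2; suff /setP/(_ u): [set x; y] = [set: G] by rewrite !inE.
  by apply/eqP; rewrite eqEcard subsetT cardsT c2 cards2 eq_sym neq_yx.
have toN u : connect (arc E) u None.
  case: u => [u|] //; case: sD => [/(VG u)/orP[]/eqP-> // | sD].
    exact: connect_trans cxy cyN.
  by apply: connect_trans cyN; apply: connect_map (sD u y).
have ofN u : connect (arc E) None u.
  case: u => [u|] //; case: sD => [/(VG u)/orP[]/eqP-> // | sD].
    exact: connect_trans cNx cxy.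
  by apply: connect_trans cNx _; apply: connect_map (sD x u).
by move=> u v; exact: connect_trans (toN u) (ofN v).
Qed.

Lemma total_kappa_cyclic_extension :
  strong E -> total_kappa D + 2 * #|G| < total_kappa E.
Proof.
move=> sE; rewrite /total_kappa.
have kG u v : kappa D u v + ((u == y) && (v == x)) <= kappa E (Some u) (Some v).
  case: eqP => [->|_] /=; last by rewrite addn0; apply: leq_kappa => //; exact: Some_inj.
  case: eqP => [->|_] /=; last by rewrite addn0; apply: leq_kappa => //; exact: Some_inj.
  rewrite addn1; apply: (@kappa_detour _ _ _ _ _ _ _ _ _ None) => //.
  - exact: Some_inj.
  - by rewrite /arc inE.
  - by rewrite /arc inE.
(* The ordered pairs split into those from [None], those into [None], and the old ones. *)
rewrite sum_option /= sum_option /=.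
rewrite [leqRHS](_ : _ = \sum_v kappa E None (Some v) + \sum_u kappa E (Some u) None
  + \sum_u \sum_(v | v != u) kappa E (Some u) (Some v)); last first.
  rewrite add0n -addnA; congr (_ + _); rewrite -big_split.
  apply: eq_bigr => u _; rewrite sum_option /=; congr (_ + _).
have -> : (\sum_u \sum_(v | v != u) kappa D u v + 2 * #|G|).+1 =
  \sum_(v : G) 1 + \sum_(u : G) 1 + \sum_u \sum_(v | v != u) (kappa D u v + ((u == y) && (v == x))).
  under [X in _ = _ + X]eq_bigr => u _ do rewrite big_split.
  by rewrite big_split /= sum_indicator_pair // sum1_card addnn -mul2n addn1 addnC addnS.
apply: leq_add; first by apply: leq_add; apply: leq_sum => u _; apply: connect_kappa_gt0.
by apply: leq_sum => u _; apply: leq_sum => v _.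
Qed.

Lemma well_orientable_cyclic_extension :
  #|G| = 2 \/ strong D -> #|G| ^ 2 <= total_kappa D + 3 ->
  well_orientable (add_vertex x y).
Proof.
move=> sD kD; have sE := cyclic_extension_strong sD.
exists E; split; [exact: cyclic_extension_orientation | by right |].
have -> : #|add_vertex x y| = #|G|.+1 by exact: card_option.
(* The gain of at least [2 * #|G| + 1] is exactly the difference of consecutive squares. *)
by move: (total_kappa_cyclic_extension sE) kD; rewrite -/E; nia.
Qed.

End AddVertexOrientation.

Lemma two_tree_well_orientable (G : sgraph) : two_tree G -> well_orientable G.
Proof.
elim=> [|{}G x y _ [D [oD sD kD]] xy|{}G H _ wG iGH].
- exact: well_orientable_K2.
- have /orP[Dxy | Dyx] : arc D x y || arc D y x by rewrite -(orientation_adj oD).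
    exact: (well_orientable_cyclic_extension oD Dxy sD kD).
  (* The extension along [y -> x] orients [add_vertex y x], which is the same graph up to the order
     of a disjunction. *)
  apply: well_orientable_iso (well_orientable_cyclic_extension oD Dyx sD kD).
  exists id; first by exists id.
  by move=> [u|] [v|] //=; exact: orbC.
- exact: well_orientable_iso iGH wG.
Qed.

(** * Book graphs and the upper bound *)

Lemma book_exists m : exists (G : sgraph) (x y : G),
  [/\ two_tree G, #|G| = m.+2, adj x y &
      forall u, u != x -> u != y -> #|nbh u| <= 2].
Proof.
elim: m => [|m [G [x [y [tG cG xy dG]]]]].
  exists K2, true, false; split; [exact: two_tree_K2 | exact: card_bool | done |].
  by case.
exists (add_vertex x y), (Some x), (Some y); split => //.
- exact: two_tree_add.
- by rewrite /= card_option cG.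
case=> [u|] ux uy.
  (* An old vertex off the spine is not adjacent to the new one, so its degree does not grow. *)
  apply: leq_trans (dG u ux uy); rewrite -(card_imset (nbh u) Some_inj).
  apply/subset_leq_card/subsetP => -[w|]; rewrite !inE /=.
    by move=> uw; apply: imset_f; rewrite inE.
  by move/orP=> [] /eqP E; rewrite E eqxx in ux uy.
apply: leq_trans (_ : #|[set Some x; Some y]| <= _); last by rewrite cards2; case: eqP.
by apply/subset_leq_card/subsetP => -[w|]; rewrite !inE.
Qed.

Lemma card_nbh (G : sgraph) (u : G) : #|nbh u| <= #|G|.-1.
Proof.
rewrite -(cardsC1 u); apply/subset_leq_card/subsetP => w.
by rewrite !inE; apply: contraTneq => ->; rewrite adj_irrefl.
Qed.

(** Symmetrizing is needed because the degree bound controls only the sum over a pair and its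
    reverse. *)
Lemma double_total_kappa (V : finType) (D : digraph V) :
  2 * total_kappa D = \sum_u \sum_(v | v != u) (kappa D u v + kappa D v u).
Proof.
under eq_bigr do rewrite big_split.
rewrite big_split /= mul2n -addnn /total_kappa; congr (_ + _).
rewrite (exchange_big_dep xpredT) //=; apply: eq_bigr => u _.
by apply: eq_bigl => v; rewrite eq_sym.
Qed.

Lemma total_kappa_book (G : sgraph) (x y : G) (D : digraph G) :
  2 < #|G| -> orientation D -> adj x y ->
  (forall u, u != x -> u != y -> #|nbh u| <= 2) ->
  total_kappa D + 3 <= #|G| ^ 2.
Proof.
move=> n3 oD xy dG.
have nxy : x != y by apply: contraTneq xy => ->; rewrite adj_irrefl.
(* The weight [#|G| - 3] on the spine raises the bound 2 to [#|G| - 1], the largest possible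
   degree. *)
pose spine (u v : G) : nat := ((u == x) && (v == y)) + ((u == y) && (v == x)).
have sum_spine : \sum_u \sum_(v | v != u) spine u v = 2.
  under eq_bigr do rewrite big_split.
  by rewrite big_split /= !sum_indicator_pair // eq_sym.
have bound u v : v != u ->
    kappa D u v + kappa D v u <= 2 + (#|G| - 3) * spine u v.
  move=> vu; case su : (spine u v) => [|k].
    rewrite muln0 addn0; move: su; rewrite /spine.
    (* Off the spine pairs, [u] or [v] has degree at most 2; the sum is symmetric, so either may
       serve. *)
    have [ux|ux] := eqVneq u x; have [uy|uy] := eqVneq u y => /=;
      last by move=> _; apply: leq_trans (kappa_sym_deg oD u v) (dG _ _ _).
    - by rewrite -ux uy eqxx in nxy.
    - case: eqVneq => // vy _; rewrite addnC.
      by apply: leq_trans (kappa_sym_deg oD v u) (dG _ _ vy); rewrite -ux.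
    - case: eqVneq => // vx _; rewrite addnC.
      by apply: leq_trans (kappa_sym_deg oD v u) (dG _ vx _); rewrite -uy.
  apply: leq_trans (kappa_sym_deg oD u v) (leq_trans (card_nbh u) _).
  by nia.
(* The right-hand side equals [2 * (#|G| ^ 2 - 3)]. *)
have : 2 * total_kappa D <= #|G| * (2 * (#|G| - 1)) + (#|G| - 3) * 2.
  rewrite double_total_kappa.
  apply: leq_trans (leq_sum _ (fun u _ => leq_sum _ (bound u))) _.
  under eq_bigr => u _ do rewrite big_split -big_distrr /=
    (sum_nat_const (predC1 u) 2) cardC1.
  by rewrite big_split /= sum_nat_const -big_distrr sum_spine -subn1 [_ * 2]mulnC.
by nia.
Qed.

(** * From totals to averages *)

Local Open Scope ring_scope.

Lemma kappa_bar_total (V : finType) (D : digraph V) :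
  kappa_bar D = (total_kappa D)%:R / (#|V|%:R * (#|V|%:R - 1)).
Proof.
rewrite /kappa_bar /total_kappa natr_sum; congr (_ / _).
by apply: eq_bigr => u _; rewrite natr_sum.
Qed.

(** The numerator is [n * (n - 1) + (n - 3) = n ^ 2 - 3]; the truncated subtraction is exact since
    [3 <= n]. *)
Lemma extremal_valueE (n : nat) : (3 <= n)%N ->
  1 + (n%:R - 3) / (n%:R * (n%:R - 1)) = (n ^ 2 - 3)%N%:R / (n%:R * (n%:R - 1)) :> rat.
Proof.
move=> n3; rewrite natrB ?natrX; last by rewrite (@leq_trans (3 ^ 2)) // leq_sqr.
have n3R : 3 <= n%:R :> rat by rewrite ler_nat.
by field; rewrite subr_eq0; apply/andP; split; apply/eqP; lra.
Qed.

Theorem theorem5p5 (n : nat) (hn : (3 <= n)%N) :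
  (forall G : sgraph, two_tree G -> #|G| = n ->
     1 + (n%:R - 3) / (n%:R * (n%:R - 1)) <= kappa_bar_max G) /\
  (exists G : sgraph,
     [/\ two_tree G, #|G| = n &
         kappa_bar_max G = 1 + (n%:R - 3) / (n%:R * (n%:R - 1))]).
Proof.
have d_gt0 : 0 < n%:R * (n%:R - 1) :> rat.
  have n3R : 3 <= n%:R :> rat by rewrite ler_nat.
  by apply: mulr_gt0; lra.
have lower (G : sgraph) : two_tree G -> #|G| = n ->
    1 + (n%:R - 3) / (n%:R * (n%:R - 1)) <= kappa_bar_max G.
  move=> /two_tree_well_orientable[D [oD _ kD]] cG.
  apply: le_trans (le_bigmax_cond _ _ oD).
  rewrite extremal_valueE // kappa_bar_total cG ler_pM2r ?invr_gt0 // ler_nat.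
  by rewrite leq_subLR addnC -cG.
split=> //; have [G [x [y [tG cG xy dG]]]] := book_exists (n - 2).
have cGn : #|G| = n by rewrite cG; lia.
exists G; split => //; apply/eqP; rewrite eq_le lower // andbT.
rewrite extremal_valueE //; apply: bigmax_le => [|D oD].
  (* The default value 0 of the maximum must also lie below the bound. *)
  by apply: divr_ge0 => //; exact: ltW.
rewrite kappa_bar_total cGn ler_pM2r ?invr_gt0 // ler_nat leq_subRL.
  by rewrite addnC -cGn; apply: total_kappa_book xy dG; rewrite ?cGn.
by rewrite (@leq_trans (3 ^ 2)) // leq_sqr.
Qed.
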